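(* Let $k$ be a field, $A$ an associative $k$-algebra, $B$ a commutative $k$-algebra and $\varepsilon:B\to A$ a morphism of $k$-algebras with $\varepsilon(B)\subset\mathcal Z(A)$. Then the cup product of cochains induces a product $$\smile:H^{*}((A,B,\varepsilon);A)\otimes H^{*}((A,B,\varepsilon);A)\to H^{*}((A,B,\varepsilon);A)$$ which makes the secondary Hochschild cohomology $H^{*}((A,B,\varepsilon);A)=\bigoplus_{n\ge 0}H^n((A,B,\varepsilon);A)$ a graded associative algebra.
   Context: All algebras are unital, $\otimes=\otimes_k$, and $\mathcal Z(A)$ is the center of $A$. Secondary Hochschild complex. Let $M$ be an $A$-bimodule with $\varepsilon(\alpha)m=m\varepsilon(\alpha)$ for all $\alpha\in B$, $m\in M$ (e.g. $M=A$). Put $C^n((A,B,\varepsilon);M)=\mathrm{Hom}_k(A^{\otimes n}\otimes B^{\otimes n(n-1)/2},M)$, with $C^0=M$. A pure tensor in $A^{\otimes n}\otimes B^{\otimes n(n-1)/2}$ is written as an upper triangular array $T=(a_i;b_{i,j})_{1\le i<j\le n}$ with diagonal entries $a_i\in A$ and entries $b_{i,j}\in B$ in position $(i,j)$, $i<j$. For $0\le p\le q\le n$, $T^p_q$ denotes the sub-array on the indices $p+1,\dots,q$, i.e. with diagonal entries $a_{p+1},\dots,a_q$ and off-diagonal entries $b_{i,j}$, $p+1\le i<j\le q$. For $T=(a_i;b_{i,j})_{1\le i<j\le n+1}$ and $1\le i\le n$, let $M_i(T)$ be the array of size $n$ obtained by merging the indices $i$ and $i+1$ into one: the merged diagonal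 entry is $\varepsilon(b_{i,i+1})a_ia_{i+1}$; for $p<i$ the entry joining $p$ to the merged index is $b_{p,i}b_{p,i+1}$; for $q>i+1$ the entry joining the merged index to $q$ is $b_{i,q}b_{i+1,q}$; all other entries are unchanged. The differential $\delta^\varepsilon_n:C^n\to C^{n+1}$ is $$\delta^\varepsilon_n(f)(T)=a_1\varepsilon\Big(\prod_{j=2}^{n+1}b_{1,j}\Big)f(T^1_{n+1})+\sum_{i=1}^n(-1)^if(M_i(T))+(-1)^{n+1}f(T^0_n)a_{n+1}\varepsilon\Big(\prod_{i=1}^{n}b_{i,n+1}\Big),$$ and $\delta^\varepsilon_0(m)(a)=am-ma$. One has $\delta^\varepsilon_{n+1}\delta^\varepsilon_n=0$, and $H^n((A,B,\varepsilon);M)$ is the cohomology of this complex. Cup product. For $f\in C^m((A,B,\varepsilon);A)$ and $g\in C^n((A,B,\varepsilon);A)$, $f\smile g\in C^{m+n}((A,B,\varepsilon);A)$ is defined on $T=(a_i;b_{i,j})_{1\le i<j\le m+n}$ by $$(f\smile g)(T)=f(T^0_m)\,g(T^m_{m+n})\prod_{\substack{1\le i\le m\\ m+1\le j\le m+n}}\varepsilon(b_{i,j}).$$ *)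

(* Defs.v *)
From HB Require Import structures.
From mathcomp Require Import all_boot all_order all_algebra.
From mathcomp Require Import boolp functions zify.

Set Implicit Arguments.
Unset Strict Implicit.
Unset Printing Implicit Defensive.

Import GRing.Theory.

Local Open Scope ring_scope.
Local Open Scope quotient_scope.

(** * Quotient of a module by a submodule *)

Section QuotientModule.
Variables (k : pzRingType) (V : lmodType k) (I : submodClosed V).

(* A copy of I carrying the [zmodClosed] structure that [Quotient.quot] expects. *)
Definition quotmod_pred : {pred V} := I.

HB.instance Definition _ := GRing.isZmodClosed.Build V quotmod_pred
  (GRing.submod_closedB (submodClosedP I)).

Definition quotmod : Type := Quotient.quot quotmod_pred.

HB.instance Definition _ := GRing.Zmodule.on quotmod.

Definition quotmod_pi (v : V) : quotmod := \pi_(Quotient.quot quotmod_pred) v.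

Lemma quotmod_piE u v : quotmod_pi u = quotmod_pi v <-> u - v \in I.
Proof.
rewrite -[_ \in I]/(u - v \in quotmod_pred) Quotient.idealrBE.
by split=> /eqP.
Qed.

Lemma quotmod_pi_surj (x : quotmod) : exists v, x = quotmod_pi v.
Proof. by exists (repr x); rewrite /quotmod_pi reprK. Qed.

Lemma quotmod_piB : zmod_morphism quotmod_pi.
Proof. exact: (raddfB \pi_(Quotient.quot quotmod_pred)). Qed.

HB.instance Definition _ :=
  GRing.isZmodMorphism.Build V quotmod quotmod_pi quotmod_piB.

Definition quotmod_scale (c : k) (x : quotmod) : quotmod :=
  quotmod_pi (c *: (repr x : V)).

Lemma quotmod_scale_pi c v : quotmod_scale c (quotmod_pi v) = quotmod_pi (c *: v).
Proof.
apply/quotmod_piE; rewrite -scalerBr rpredZ //.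
by apply/quotmod_piE; rewrite /quotmod_pi reprK.
Qed.

Lemma quotmod_scaleA a b v :
  quotmod_scale a (quotmod_scale b v) = quotmod_scale (a * b) v.
Proof. by have [u ->] := quotmod_pi_surj v; rewrite !quotmod_scale_pi scalerA. Qed.

Lemma quotmod_scale1 : left_id 1 quotmod_scale.
Proof. by move=> v; have [u ->] := quotmod_pi_surj v; rewrite quotmod_scale_pi scale1r. Qed.

Lemma quotmod_scaleDr : right_distributive quotmod_scale +%R.
Proof.
move=> a v w; have [u ->] := quotmod_pi_surj v; have [t ->] := quotmod_pi_surj w.
by rewrite -raddfD !quotmod_scale_pi scalerDr raddfD.
Qed.

Lemma quotmod_scaleDl v : {morph quotmod_scale^~ v : a b / a + b}.
Proof.
move=> a b; have [u ->] := quotmod_pi_surj v.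
by rewrite !quotmod_scale_pi scalerDl raddfD.
Qed.

HB.instance Definition _ := GRing.Zmodule_isLmodule.Build k quotmod
  quotmod_scaleA quotmod_scale1 quotmod_scaleDr quotmod_scaleDl.

Lemma quotmod_pi_scalable : scalable quotmod_pi.
Proof. by move=> c v; rewrite -quotmod_scale_pi. Qed.

HB.instance Definition _ :=
  GRing.isScalable.Build k V quotmod *:%R quotmod_pi quotmod_pi_scalable.

End QuotientModule.

(** * Direct sum of a sequence of modules *)

Section DirectSum.
Variables (k : pzRingType) (V : nat -> lmodType k).

Record dsum := DSum {
  dsum_val :> forall n, V n;
  dsum_finite : exists N, forall n, (N <= n)%N -> dsum_val n = 0 }.

HB.instance Definition _ := gen_eqMixin dsum.
HB.instance Definition _ := gen_choiceMixin dsum.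

Lemma dsumP (x y : dsum) : (forall n, x n = y n) -> x = y.
Proof.
case: x y => [x Hx] [y Hy] /= xy.
have e : x = y by apply: functional_extensionality_dep.
by case: _ / e Hy => Hy; congr DSum; exact: Prop_irrelevance.
Qed.

Lemma dsum0_subproof : exists N, forall n, (N <= n)%N -> (0 : V n) = 0.
Proof. by exists 0%N. Qed.
Definition dsum0 := DSum dsum0_subproof.

Lemma dsumD_subproof (x y : dsum) :
  exists N, forall n, (N <= n)%N -> x n + y n = 0.
Proof.
have [N HN] := dsum_finite x; have [M HM] := dsum_finite y.
exists (maxn N M) => n; rewrite geq_max => /andP[Nn Mn].
by rewrite HN // HM // addr0.
Qed.
Definition dsumD x y := DSum (dsumD_subproof x y).

Lemma dsumN_subproof (x : dsum) : exists N, forall n, (N <= n)%N -> - x n = 0.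
Proof. by have [N HN] := dsum_finite x; exists N => n /HN->; rewrite oppr0. Qed.
Definition dsumN x := DSum (dsumN_subproof x).

Lemma dsumZ_subproof c (x : dsum) : exists N, forall n, (N <= n)%N -> c *: x n = 0.
Proof. by have [N HN] := dsum_finite x; exists N => n /HN->; rewrite scaler0. Qed.
Definition dsumZ c x := DSum (dsumZ_subproof c x).

Lemma dsumDA : associative dsumD.
Proof. by move=> x y z; apply: dsumP => n; exact: addrA. Qed.
Lemma dsumDC : commutative dsumD.
Proof. by move=> x y; apply: dsumP => n; exact: addrC. Qed.
Lemma dsum0D : left_id dsum0 dsumD.
Proof. by move=> x; apply: dsumP => n; exact: add0r. Qed.
Lemma dsumND : left_inverse dsum0 dsumN dsumD.
Proof. by move=> x; apply: dsumP => n; exact: addNr. Qed.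

HB.instance Definition _ :=
  GRing.isZmodule.Build dsum dsumDA dsumDC dsum0D dsumND.

Lemma dsumZA a b x : dsumZ a (dsumZ b x) = dsumZ (a * b) x.
Proof. by apply: dsumP => n; exact: scalerA. Qed.
Lemma dsum1Z : left_id 1 dsumZ.
Proof. by move=> x; apply: dsumP => n; exact: scale1r. Qed.
Lemma dsumZDr : right_distributive dsumZ +%R.
Proof. by move=> c x y; apply: dsumP => n; exact: scalerDr. Qed.
Lemma dsumZDl x : {morph dsumZ^~ x : a b / a + b}.
Proof. by move=> a b; apply: dsumP => n; exact: scalerDl. Qed.

HB.instance Definition _ :=
  GRing.Zmodule_isLmodule.Build k dsum dsumZA dsum1Z dsumZDr dsumZDl.

Lemma dsum_in_subproof n (x : V n) :
  exists N, forall m, (N <= m)%N -> dfwith (fun m => 0 : V m) x m = 0.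
Proof.
by exists n.+1 => m nm; rewrite dfwith_out // ltn_eqF.
Qed.

Definition dsum_in n (x : V n) : dsum := DSum (dsum_in_subproof x).

Lemma dsum_in_linear n : linear (@dsum_in n).
Proof.
move=> c x y; apply: dsumP => m /=.
have [e|nm] := eqVneq n m; last by rewrite !dfwith_out // scaler0 addr0.
by case: _ / e; rewrite !dfwith_in.
Qed.

HB.instance Definition _ n := GRing.isLinear.Build k (V n) dsum *:%R
  (@dsum_in n) (@dsum_in_linear n).

(* [mul] makes [dsum] a graded associative algebra, with unit in degree 0. *)
Definition graded_algebra (mul : dsum -> dsum -> dsum) : Prop :=
  [/\ (forall x, linear (mul x)) /\ (forall y, linear (mul^~ y)),
      associative mul,
      exists u : V 0%N, left_id (dsum_in u) mul /\ right_id (dsum_in u) mul &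
      forall m n (x : V m) (y : V n),
        exists z : V (m + n)%N, mul (dsum_in x) (dsum_in y) = dsum_in z].

End DirectSum.

(** * Linearity of compound expressions *)

Section Linearity.
Variable k : pzRingType.

Lemma linC (U : lmodType k) (V : algType k) (F : U -> V) a b :
  linear F -> linear (fun x => a * F x * b).
Proof. by move=> l c x y; rewrite l mulrDr mulrDl -scalerAr -scalerAl. Qed.

Lemma linCl (U : lmodType k) (V : algType k) (F : U -> V) a :
  linear F -> linear (fun x => a * F x).
Proof. by move=> l c x y; rewrite l mulrDr -scalerAr. Qed.

Lemma linCr (U : lmodType k) (V : algType k) (F : U -> V) b :
  linear F -> linear (fun x => F x * b).
Proof. by move=> l c x y; rewrite l mulrDl -scalerAl. Qed.

Lemma linD (U V : lmodType k) (F G : U -> V) :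
  linear F -> linear G -> linear (fun x => F x + G x).
Proof. by move=> lF lG c x y; rewrite lF lG scalerDr addrACA. Qed.

Lemma linsum (U V : lmodType k) (I : finType) (F : I -> U -> V) :
  (forall i, linear (F i)) -> linear (fun x => \sum_i F i x).
Proof.
move=> lF c x y; rewrite scaler_sumr -big_split /=; apply: eq_bigr => i _; exact: lF.
Qed.

Lemma linprod (U : lmodType k) (I : eqType) (s : seq I) (V : algType k)
    (F : U -> I -> V) (i : I) :
  uniq s -> i \in s -> linear (F^~ i) ->
  (forall x j, j != i -> F x j = F 0 j) -> linear (fun x => \prod_(j <- s) F x j).
Proof.
move=> us si l c.
have e x : \prod_(j <- s) F x j =
  (\prod_(j <- take (index i s) s) F 0 j) * F x i *
  (\prod_(j <- drop (index i s).+1 s) F 0 j).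
  rewrite -{1}(cat_take_drop (index i s) s) big_cat /=.
  rewrite (drop_nth i) ?index_mem // nth_index // big_cons mulrA.
  have := us; rewrite -{1}(cat_take_drop (index i s) s) (drop_nth i) ?index_mem //.
  rewrite nth_index // cat_uniq /= => /and3P[_ /norP[nt _] /andP[nd _]].
  congr (_ * _ * _); apply: eq_big_seq => j js; apply: c.
    by apply: contraNneq nt => ji; rewrite -{1}ji.
  by apply: contraNneq nd => ji; rewrite -{1}ji.
by move=> a x y; rewrite !e; exact: (linC (F := F^~ i) _ _ l).
Qed.

End Linearity.

(** * Triangular arrays *)

(* Rows, columns and merging positions are numbered from 0. *)
Record tri (A B : Type) (n : nat) := Tri {
  diag : 'I_n -> A;
  offd : {p : 'I_n * 'I_n | (p.1 < p.2)%N} -> B }.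

Section Arrays.
Variables (k : fieldType) (A : algType k) (B : comAlgType k).
Implicit Types m n : nat.

Lemma triP n (S T : tri A B n) : diag S =1 diag T -> offd S =1 offd T -> S = T.
Proof.
by case: S T => [a b] [a' b'] /= /funext -> /funext ->.
Qed.

Definition set_diag n (T : tri A B n) i x : tri A B n :=
  Tri [eta diag T with i |-> x] (offd T).

Definition set_offd n (T : tri A B n) p y : tri A B n :=
  Tri (diag T) [eta offd T with p |-> y].

(* The value 1 outside the strict upper triangle is a dummy: no definition
   below reads an entry there. *)
Definition entry n (T : tri A B n) (i j : 'I_n) : B :=
  if insub (i, j) is Some p then offd T p else 1.

Definition of_entries n (a : 'I_n -> A) (b : 'I_n -> 'I_n -> B) : tri A B n :=
  Tri a (fun p => b (val p).1 (val p).2).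

(* [subarray h T] is the sub-array of T on the indices in the image of h,
   for h strictly increasing. *)
Definition subarray m n (h : 'I_m -> 'I_n) (T : tri A B n) : tri A B m :=
  of_entries (fun i => diag T (h i)) (fun i j => entry T (h i) (h j)).

(** * Cochains *)

(* Linear maps out of the tensor product of n copies of A and n(n-1)/2 copies
   of B are represented by the corresponding multilinear maps on arrays. *)
Definition multilinear n (f : tri A B n -> A) : Prop :=
  (forall T i, linear (fun x => f (set_diag T i x))) /\
  (forall T p, linear (fun y => f (set_offd T p y))).

Definition is_cochain n : {pred tri A B n -> A} :=
  [pred f | `[< multilinear f >]].
Arguments is_cochain : clear implicits.

Lemma is_cochain_submod_closed n : submod_closed (is_cochain n).
Proof.
split=> [|c f g /asboolP[fa fb] /asboolP[ga gb]]; apply/asboolP; split=> T i a x y /=.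
- by rewrite scaler0 addr0.
- by rewrite scaler0 addr0.
- rewrite !fctE [f _]fa [g _]ga !scalerDr !scalerA [c * a]mulrC.
  by rewrite addrACA.
- rewrite !fctE [f _]fb [g _]gb !scalerDr !scalerA [c * a]mulrC.
  by rewrite addrACA.
Qed.

HB.instance Definition _ n := GRing.isSubmodClosed.Build k (tri A B n -> A)
  (is_cochain n) (is_cochain_submod_closed n).

Record cochain n := Cochain {
  cochain_val :> tri A B n -> A;
  cochain_valP : cochain_val \in is_cochain n }.

HB.instance Definition _ n := [isSub for @cochain_val n].
HB.instance Definition _ n := [Choice of cochain n by <:].
HB.instance Definition _ n := [SubChoice_isSubLmodule of cochain n by <:].

Lemma cochainP n (f g : cochain n) : (forall T, f T = g T) -> f = g.
Proof. by move=> fg; apply: val_inj; apply: funext. Qed.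


Lemma linear_slot (U : lmodType k) n (f : cochain n) (F : U -> tri A B n) :
  (exists2 i, linear (fun x => diag (F x) i) &
     (forall x j, j != i -> diag (F x) j = diag (F 0) j) /\
     (forall x p, offd (F x) p = offd (F 0) p)) \/
  (exists2 p, linear (fun x => offd (F x) p) &
     (forall x i, diag (F x) i = diag (F 0) i) /\
     (forall x q, q != p -> offd (F x) q = offd (F 0) q)) ->
  linear (fun x => f (F x)).
Proof.
have /asboolP[fa fb] := cochain_valP f.
case=> [[i li [Fa Fb]]|[p lp [Fa Fb]]].
  have e x : F x = set_diag (F 0) i (diag (F x) i).
    by apply: triP => [j|p] //=; case: (eqVneq j i) => [->//|]; exact: Fa.
  by move=> c x y; rewrite e li fa -!e.
have e x : F x = set_offd (F 0) p (offd (F x) p).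
  by apply: triP => [j|q] //=; case: (eqVneq q p) => [->//|]; exact: Fb.
by move=> c x y; rewrite e lp fb -!e.
Qed.

Lemma entry_set_offd n (T : tri A B n) p y (i j : 'I_n) :
  entry (set_offd T p y) i j = if (i, j) == val p then y else entry T i j.
Proof.
rewrite /entry /=; case: insubP => /= [q _ qE|].
  by rewrite -qE (inj_eq val_inj).
by move=> ij; case: eqP => // e; case: p e => -[p1 p2] /= pp [e1 e2]; rewrite e1 e2 pp in ij.
Qed.

Lemma linear_subarray_diag m n (h : 'I_m -> 'I_n) (f : cochain m) (T : tri A B n) i :
  injective h -> linear (fun x => f (subarray h (set_diag T (h i) x))).
Proof.
move=> hi; apply: linear_slot; left; exists i; first by move=> c x y /=; rewrite eqxx.
by split=> // x j ji /=; rewrite (inj_eq hi) (negPf ji).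
Qed.

Lemma linear_subarray_offd m n (h : 'I_m -> 'I_n) (f : cochain m) (T : tri A B n)
    (p : {p : 'I_m * 'I_m | (p.1 < p.2)%N}) (q : {p : 'I_n * 'I_n | (p.1 < p.2)%N}) :
  injective h -> val q = (h (val p).1, h (val p).2) ->
  linear (fun y => f (subarray h (set_offd T q y))).
Proof.
move=> hi qE; apply: linear_slot; right; exists p.
  by move=> c x y /=; rewrite !entry_set_offd qE eqxx.
split=> // x r rp /=; rewrite !entry_set_offd qE; case: eqP => // -[/hi e1 /hi e2].
by case/eqP: rp; apply: val_inj; rewrite [LHS]surjective_pairing [RHS]surjective_pairing; congr pair.
Qed.

Lemma subarray_set_diag m n (h : 'I_m -> 'I_n) (T : tri A B n) i x :
  (forall j, h j != i) -> subarray h (set_diag T i x) = subarray h T.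
Proof. by move=> hi; apply: triP => [j|p] //=; rewrite (negPf (hi j)). Qed.

Lemma subarray_set_offd m n (h : 'I_m -> 'I_n) (T : tri A B n) p y :
  (forall i j, (h i, h j) != val p) -> subarray h (set_offd T p y) = subarray h T.
Proof. by move=> hp; apply: triP => [j|q] //=; rewrite entry_set_offd (negPf (hp _ _)). Qed.

Variable eps : {lrmorphism B -> A}.

Lemma lineps (U : lmodType k) (F : U -> B) : linear F -> linear (fun x => eps (F x)).
Proof. by move=> l c x y; rewrite l linearP. Qed.

(* Merging the indices i and i+1. The index r of the merged array stands for
   the index [lift i1 r] of T, that is r if r <= i and r+1 if r > i. *)
Definition merge n (i : 'I_n) (T : tri A B n.+1) : tri A B n :=
  let i0 := widen_ord (leqnSn n) i in
  let i1 := lift ord0 i in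
  of_entries
    (fun r => if r == i then eps (entry T i0 i1) * diag T i0 * diag T i1
              else diag T (lift i1 r))
    (fun r s =>
       if s == i then entry T (lift i1 r) i0 * entry T (lift i1 r) i1
       else if r == i then entry T i0 (lift i1 s) * entry T i1 (lift i1 s)
       else entry T (lift i1 r) (lift i1 s)).

(** * Differential and cup product, with coefficients in A *)

(* [subarray (lift ord0) T] drops the first index of T and
   [subarray (widen_ord (leqnSn n)) T] the last one; merging at i : 'I_n carries
   the sign of i.+1 because of the numbering from 0. *)

Definition delta_fun n (f : tri A B n -> A) (T : tri A B n.+1) : A :=
  diag T ord0 * eps (\prod_(j < n) entry T ord0 (lift ord0 j))
    * f (subarray (lift ord0) T)
  + \sum_(i < n) (-1) ^+ i.+1 * f (merge i T)
  + (-1) ^+ n.+1 * f (subarray (widen_ord (leqnSn n)) T)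
    * diag T ord_max
    * eps (\prod_(i < n) entry T (widen_ord (leqnSn n) i) ord_max).

Definition cup_fun m n (f : tri A B m -> A) (g : tri A B n -> A)
    (T : tri A B (m + n)) : A :=
  f (subarray (@lshift m n) T) * g (subarray (@rshift m n) T)
  * \prod_(i < m) \prod_(j < n) eps (entry T (lshift n i) (rshift m j)).

Lemma liftS0 n (i : 'I_n) : lift (lift ord0 i) i = widen_ord (leqnSn n) i.
Proof. by apply: val_inj; rewrite /= /bump; case: ltngtP; lia. Qed.


Lemma widen_inj n : injective (widen_ord (leqnSn n)).
Proof. by move=> i j /(congr1 val) /= ij; exact: val_inj. Qed.

Lemma widenP n (i : 'I_n.+1) : i = ord_max \/ exists j, i = widen_ord (leqnSn n) j.
Proof.
case: (unliftP ord_max i) => [j ->|->]; [right; exists j|by left].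
by apply: val_inj => /=; rewrite /bump leqNgt ltn_ord.
Qed.

Lemma widen_neq n (j : 'I_n) : (widen_ord (leqnSn n) j == ord_max) = false.
Proof. by rewrite -val_eqE /= ltn_eqF. Qed.

Section Delta.
Variables (n : nat) (f : cochain n).

Lemma linear_merge_diag (T : tri A B n.+1) i p :
  linear (fun x => f (merge i (set_diag T p x))).
Proof.
apply: linear_slot; left.
pose i0 := widen_ord (leqnSn n) i; pose i1 := lift ord0 i.
have i01 : (i0 == i1) = false by rewrite -val_eqE /= /bump /=; lia.
have i10 : (i1 == i0) = false by rewrite eq_sym.
have i0E : lift i1 i = i0 by exact: liftS0.
case: (unliftP i1 p) => [r ->|->]; last first.
  exists i; last first.
    split=> // x j ji /=; rewrite (negPf ji) -/i1 (eq_sym _ i1) (negPf (neq_lift _ _)) //.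
  move=> c x y /=; rewrite !eqxx -/i0 -/i1 i01.
  by rewrite mulrDr -scalerAr.
exists r; last first.
  split=> // x j jr /=; rewrite (inj_eq lift_inj) (negPf jr) -/i0 -/i1.
  rewrite (negPf (neq_lift _ _)) -i0E (inj_eq lift_inj).
  by case: eqP => // <-; rewrite (negPf jr).
move=> c x y /=; rewrite eqxx; case: eqP => // ->.
rewrite -/i1 -/i0 i0E eqxx i10.
by rewrite mulrDr mulrDl -scalerAr -scalerAl.
Qed.

Lemma linear_merge_offd (T : tri A B n.+1) i p :
  linear (fun y => f (merge i (set_offd T p y))).
Proof.
pose i0 := widen_ord (leqnSn n) i; pose i1 := lift ord0 i.
have i01 : (i0 == i1) = false by rewrite -val_eqE /= /bump /=; lia.
have i10 : (i1 == i0) = false by rewrite eq_sym.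
have i0E : lift i1 i = i0 by exact: liftS0.
have i1l r : (lift i1 r == i1) = false by rewrite eq_sym (negPf (neq_lift _ _)).
have i0l r : (lift i1 r == i0) = (r == i) by rewrite -i0E (inj_eq lift_inj).
have li r s : (lift i1 r == lift i1 s) = (r == s) by exact: (inj_eq lift_inj).
case: p => -[p1 p2] /= p12.
case: (boolP ((p1 == i0) && (p2 == i1))) => [/andP[/eqP p1E /eqP p2E]|pi].
  apply: linear_slot; left; exists i.
    move=> c x y /=; rewrite eqxx !entry_set_offd /= -/i0 -/i1 p1E p2E !eqxx.
    by rewrite linearP !mulrDl -!scalerAl.
  split=> [x j ji|x [[r s] rs]] /=; first by rewrite (negPf ji).
  rewrite !entry_set_offd /= p1E p2E !xpair_eqE -/i0 -/i1 !i1l i01 !andbF.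
  rewrite i0l; case: (eqVneq r i) => [ri|] //=; case: eqP => // si.
  by rewrite /= ri si ltnn in rs.
have [r rE] : exists r, (p1 == lift i1 r) || (p1 == i1) && (r == i).
  by case: (unliftP i1 p1) => [r ->|->]; [exists r|exists i]; rewrite !eqxx ?orbT.
have [s sE] : exists s, (p2 == lift i1 s) || (p2 == i1) && (s == i).
  by case: (unliftP i1 p2) => [s ->|->]; [exists s|exists i]; rewrite !eqxx ?orbT.
have rs : (r < s)%N.
  move: p12 pi rE sE; rewrite -!val_eqE /= /bump; lia.
have E := (i1l, i0l, li, i01, i10, fun r => etrans (eq_sym _ _) (i1l r),
  fun r => etrans (eq_sym _ _) (i0l r), eqxx).
apply: linear_slot; right; exists (exist _ (r, s) rs) => /=.
  move=> c x y /=; rewrite !entry_set_offd /= !xpair_eqE -/i0 -/i1.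
  case/orP: rE => [/eqP p1E|/andP[/eqP p1E /eqP rE]];
    case/orP: sE => [/eqP p2E|/andP[/eqP p2E /eqP sE]]; rewrite p1E p2E ?rE ?sE;
    rewrite !E /=.
  - by case: (s == i); case: (r == i); rewrite /= ?mulrDl ?mulrDr -?scalerAl -?scalerAr.
  - by rewrite mulrDr -scalerAr.
  - case: eqP => [si|_]; first by rewrite rE si ltnn in rs.
    by rewrite mulrDr -scalerAr.
  - by rewrite rE sE ltnn in rs.
split=> [x t|x [[t u] tu] tup] /=; rewrite !entry_set_offd /= !xpair_eqE -/i0 -/i1.
  by rewrite ![i0 == _]eq_sym ![i1 == _]eq_sym (negPf pi).
have {tup} neq : (t == r) && (u == s) = false.
  by move: tup; rewrite -val_eqE /= xpair_eqE => /negPf.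
case/orP: rE => [/eqP p1E|/andP[/eqP p1E /eqP rE]];
    case/orP: sE => [/eqP p2E|/andP[/eqP p2E /eqP sE]];
    rewrite p1E p2E ?rE ?sE !E /=.
- case: (eqVneq u i) => ui.
    by move: neq; rewrite ui [i == s]eq_sym => ->; rewrite andbF.
  by case: (eqVneq t i) neq => [->|_] => [|->//]; rewrite [i == r]eq_sym => ->.
- by case: (eqVneq u i) neq => [->|_]; rewrite ?sE ?eqxx ?andbF // => ->.
- by case: (eqVneq t i) neq => [->|//]; rewrite rE eqxx /= => ->.
- by [].
Qed.

Lemma linear_delta_diag (T : tri A B n.+1) p :
  linear (fun x => delta_fun f (set_diag T p x)).
Proof.
apply: linD; first apply: linD.
- case: (unliftP ord0 p) => [j ->|->] c x y.
    apply: (linCl (F := fun x => f (subarray _ (set_diag T _ x)))).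
    exact/linear_subarray_diag/lift_inj.
  rewrite !subarray_set_diag; try by move=> j; rewrite eq_sym neq_lift.
  by rewrite /= !mulrDl -!scalerAl.
- by apply: linsum => i; apply: linCl; exact: linear_merge_diag.
- case: (widenP p) => [->|[j ->]] c x y.
    rewrite !subarray_set_diag; try by move=> j; rewrite widen_neq.
    by rewrite /= eqxx !mulrDr !mulrDl -!scalerAr -!scalerAl.
  rewrite /= ![ord_max == _]eq_sym widen_neq.
  have lF := linear_subarray_diag f T j (@widen_inj n).
  exact: (linCr _ (linCr _ (linCl _ lF))).
Qed.

Lemma linear_delta_offd (T : tri A B n.+1) p :
  linear (fun y => delta_fun f (set_offd T p y)).
Proof.
apply: linD; first apply: linD.
- case: (unliftP ord0 (val p).2) => [s sE|p0]; last first.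
    by have := valP p; rewrite p0.
  case: (unliftP ord0 (val p).1) => [r rE|rE] c x y.
    have rs : (r < s)%N by have := valP p; rewrite rE sE.
    pose F y := f (subarray (lift ord0) (set_offd T p y)).
    have lF : linear F.
      apply: (@linear_subarray_offd _ _ _ _ _ (exist _ (r, s) rs)) => //.
        exact: lift_inj.
      by rewrite -rE -sE -surjective_pairing.
    have e z : \prod_(j < n) entry (set_offd T p z) ord0 (lift ord0 j) =
               \prod_(j < n) entry T ord0 (lift ord0 j).
      apply: eq_bigr => j _; rewrite entry_set_offd [val p]surjective_pairing rE.
      by rewrite xpair_eqE (negPf (neq_lift _ _)).
    by rewrite !e /=; exact: (linCl _ lF).
  have lG : linear (fun y => eps (\prod_(j < n) entry (set_offd T p y) ord0 (lift ord0 j))).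
    apply: lineps; apply: (linprod (i := s)) => [|||z j js].
    + exact: index_enum_uniq.
    + exact: mem_index_enum.
    + by move=> a u v; rewrite !entry_set_offd [val p]surjective_pairing rE sE eqxx.
    + rewrite !entry_set_offd [val p]surjective_pairing rE sE xpair_eqE.
      by rewrite (inj_eq lift_inj) (negPf js) andbF.
  rewrite !subarray_set_offd; try by move=> i j;
    rewrite [val p]surjective_pairing rE xpair_eqE eq_sym (negPf (neq_lift _ _)).
  exact: (linC _ _ lG).
- by apply: linsum => i; apply: linCl; exact: linear_merge_offd.
- case: (widenP (val p).1) => [pm|[r rE]].
    by have := valP p; rewrite pm /= ltnNge -ltnS ltn_ord.
  case: (widenP (val p).2) => [sE|[s sE]] c x y; last first.
    have rs : (r < s)%N by have := valP p; rewrite rE sE.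
    pose F y := f (subarray (widen_ord (leqnSn n)) (set_offd T p y)).
    have lF : linear F.
      apply: (@linear_subarray_offd _ _ _ _ _ (exist _ (r, s) rs)) => //.
        exact: widen_inj.
      by rewrite -rE -sE -surjective_pairing.
    have e z : \prod_(i < n) entry (set_offd T p z) (widen_ord (leqnSn n) i) ord_max =
               \prod_(i < n) entry T (widen_ord (leqnSn n) i) ord_max.
      apply: eq_bigr => j _; rewrite entry_set_offd [val p]surjective_pairing sE.
      by rewrite xpair_eqE [ord_max == _]eq_sym widen_neq andbF.
    by rewrite !e /=; exact: (linCr _ (linCr _ (linCl _ lF))).
  have lG : linear (fun y => eps (\prod_(i < n)
        entry (set_offd T p y) (widen_ord (leqnSn n) i) ord_max)).
    apply: lineps; apply: (linprod (i := r)) => [|||z j jr].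
    + exact: index_enum_uniq.
    + exact: mem_index_enum.
    + by move=> a u v; rewrite !entry_set_offd [val p]surjective_pairing rE sE eqxx.
    + rewrite !entry_set_offd [val p]surjective_pairing rE sE xpair_eqE.
      by rewrite (inj_eq (@widen_inj _)) (negPf jr).
  rewrite !subarray_set_offd; try by move=> i j;
    rewrite [val p]surjective_pairing sE xpair_eqE widen_neq andbF.
  exact: (linCl _ lG).
Qed.

Lemma delta_cochain : delta_fun f \in is_cochain n.+1.
Proof.
by apply/asboolP; split=> T p; [exact: linear_delta_diag|exact: linear_delta_offd].
Qed.

Definition delta : cochain n.+1 := Cochain delta_cochain.

End Delta.

Lemma delta_linear n : linear (@delta n).
Proof.
move=> c f g; apply: cochainP => T.
change (delta_fun (c *: f + g : cochain n) T = c *: delta_fun f T + delta_fun g T).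
have e n' (u v : cochain n') S : (c *: u + v) S = c *: u S + v S by [].
rewrite /delta_fun !e (eq_bigr (fun i : 'I_n =>
  c *: ((-1) ^+ i.+1 * f (merge i T)) + (-1) ^+ i.+1 * g (merge i T))); last first.
  by move=> i _; rewrite e mulrDr -scalerAr.
rewrite big_split /= -scaler_sumr !mulrDr !mulrDl -!scalerAr -!scalerAl !scalerDr.
by rewrite [RHS]addrACA; congr (_ + _); rewrite addrACA.
Qed.

HB.instance Definition _ n := GRing.isLinear.Build k (cochain n) (cochain n.+1)
  *:%R (@delta n) (@delta_linear n).

Section Cup.
Variables (m n : nat) (f : cochain m) (g : cochain n).

Lemma cup_cochain : cup_fun f g \in is_cochain (m + n).
Proof.
apply/asboolP; split=> T p; rewrite /cup_fun.
  case: (split_ordP p) => i -> c x y.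
    have eR z : subarray (@rshift m n) (set_diag T (lshift n i) z) =
                subarray (@rshift m n) T.
      by apply: subarray_set_diag => j; rewrite eq_rlshift.
    rewrite !eR.
    have lF := linear_subarray_diag f T i (@lshift_inj m n).
    exact: (linCr _ (linCr _ lF)).
  have eL z : subarray (@lshift m n) (set_diag T (rshift m i) z) =
              subarray (@lshift m n) T.
    by apply: subarray_set_diag => j; rewrite eq_lrshift.
  rewrite !eL.
  have lG := linear_subarray_diag g T i (@rshift_inj m n).
  exact: (linC _ _ lG).
have pE := surjective_pairing (val p).
case: (split_ordP (val p).1) => r rE; case: (split_ordP (val p).2) => s sE;
  rewrite rE sE in pE; move=> c x y.
- have rs : (r < s)%N by have := valP p; rewrite pE.
  pose F y := f (subarray (@lshift m n) (set_offd T p y)).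
  have lF : linear F.
    apply: (@linear_subarray_offd _ _ _ _ _ (exist _ (r, s) rs)) => //.
    exact: lshift_inj.
  have e z i j : entry (set_offd T p z) (lshift n i) (rshift m j) =
                 entry T (lshift n i) (rshift m j).
    by rewrite entry_set_offd pE xpair_eqE eq_rlshift andbF.
  have e' z : \prod_(i < m) \prod_(j < n)
                eps (entry (set_offd T p z) (lshift n i) (rshift m j)) =
              \prod_(i < m) \prod_(j < n) eps (entry T (lshift n i) (rshift m j)).
    by apply: eq_bigr => i _; apply: eq_bigr => j _; rewrite e.
  have eR z : subarray (@rshift m n) (set_offd T p z) = subarray (@rshift m n) T.
    by apply: subarray_set_offd => i j; rewrite pE xpair_eqE eq_rlshift.
  by rewrite !eR !e'; exact: (linCr _ (linCr _ lF)).
- have lP : linear (fun y => \prod_(i < m) \prod_(j < n)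
                eps (entry (set_offd T p y) (lshift n i) (rshift m j))).
    apply: (linprod (i := r)); [exact: index_enum_uniq|exact: mem_index_enum| |].
      apply: (linprod (i := s)); [exact: index_enum_uniq|exact: mem_index_enum| |].
        by apply: lineps => a u v; rewrite !entry_set_offd pE eqxx.
      move=> z j js; rewrite !entry_set_offd pE xpair_eqE.
      by rewrite (inj_eq (@rshift_inj _ _)) (negPf js) andbF.
    move=> z i ir; apply: eq_bigr => j _; rewrite !entry_set_offd pE xpair_eqE.
    by rewrite (inj_eq (@lshift_inj _ _)) (negPf ir).
  have eR z : subarray (@rshift m n) (set_offd T p z) = subarray (@rshift m n) T.
    by apply: subarray_set_offd => i j; rewrite pE xpair_eqE eq_rlshift.
  have eL z : subarray (@lshift m n) (set_offd T p z) = subarray (@lshift m n) T.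
    by apply: subarray_set_offd => i j; rewrite pE xpair_eqE eq_lrshift andbF.
  by rewrite !eR !eL; exact: (linCl _ lP).
- by have := valP p; rewrite pE /= ltnNge ltnW // ltn_addr.
- have rs : (r < s)%N by have := valP p; rewrite pE /= ltn_add2l.
  pose G y := g (subarray (@rshift m n) (set_offd T p y)).
  have lG : linear G.
    apply: (@linear_subarray_offd _ _ _ _ _ (exist _ (r, s) rs)) => //.
    exact: rshift_inj.
  have e z i j : entry (set_offd T p z) (lshift n i) (rshift m j) =
                 entry T (lshift n i) (rshift m j).
    by rewrite entry_set_offd pE xpair_eqE eq_lrshift.
  have e' z : \prod_(i < m) \prod_(j < n)
                eps (entry (set_offd T p z) (lshift n i) (rshift m j)) =
              \prod_(i < m) \prod_(j < n) eps (entry T (lshift n i) (rshift m j)).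
    by apply: eq_bigr => i _; apply: eq_bigr => j _; rewrite e.
  have eL z : subarray (@lshift m n) (set_offd T p z) = subarray (@lshift m n) T.
    by apply: subarray_set_offd => i j; rewrite pE xpair_eqE eq_lrshift.
  by rewrite !eL !e'; exact: (linC _ _ lG).
Qed.

Definition cup : cochain (m + n) := Cochain cup_cochain.

End Cup.

(** * Cohomology *)

Definition is_cocycle n : {pred cochain n} := [pred f | delta f == 0].
Arguments is_cocycle : clear implicits.

Lemma is_cocycle_submod_closed n : submod_closed (is_cocycle n).
Proof.
split=> [|c f g]; rewrite !inE ?linear0 //.
by move=> /eqP df /eqP dg; rewrite linearP /= df dg scaler0 addr0.
Qed.

HB.instance Definition _ n := GRing.isSubmodClosed.Build k (cochain n)
  (is_cocycle n) (@is_cocycle_submod_closed n).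

Record cocycle n := Cocycle {
  cocycle_val :> cochain n;
  cocycle_valP : cocycle_val \in is_cocycle n }.

HB.instance Definition _ n := [isSub for @cocycle_val n].
HB.instance Definition _ n := [Choice of cocycle n by <:].
HB.instance Definition _ n := [SubChoice_isSubLmodule of cocycle n by <:].

(* Coboundaries are taken inside the cocycles; when eps is central, every value
   of delta is a cocycle, so nothing is lost. *)
Definition coboundary n : {pred cocycle n} :=
  match n return {pred cocycle n} with
  | 0 => [pred f | f == 0]
  | m.+1 => [pred f | `[< exists g : cochain m, cocycle_val f = delta g >]]
  end.
Arguments coboundary : clear implicits.

Lemma coboundary_submod_closed n : submod_closed (coboundary n).
Proof.
case: n => [|n]; split=> [|c f g]; rewrite !inE //.
- by move=> /eqP-> /eqP->; rewrite scaler0 addr0.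
- by apply/asboolP; exists 0; rewrite linear0.
- move=> /asboolP[f' fE] /asboolP[g' gE]; apply/asboolP; exists (c *: f' + g').
  by rewrite linearP /= -fE -gE.
Qed.

HB.instance Definition _ n := GRing.isSubmodClosed.Build k (cocycle n)
  (coboundary n) (@coboundary_submod_closed n).

Definition cohomology n : lmodType k := quotmod (coboundary n).

Definition cohomology_class n (f : cocycle n) : cohomology n :=
  quotmod_pi (coboundary n) f.

Definition total_cohomology : lmodType k := dsum cohomology.

End Arrays.

(* Main.v *)
(** The Leibniz rule d(f g) = (df) g + (-1)^m f (dg) for f of degree m shows that
cocycles are closed under the cup product, and that the product of a coboundary
with a cocycle is a coboundary; hence the cup product descends to classes. The
products over pairs (i, j) of indices in its definition are unchanged by merging
two consecutive indices, which is what the Leibniz rule rests on. The cup product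
is associative already on cochains, with the constant 0-cochain 1 as unit, and by
bilinearity it suffices to check associativity on homogeneous classes. *)

Require Import Defs.
From HB Require Import structures.
From mathcomp Require Import all_boot all_order all_algebra.
From mathcomp Require Import boolp functions zify.

Set Implicit Arguments.
Unset Strict Implicit.
Unset Printing Implicit Defensive.

Import GRing.Theory.

Local Open Scope ring_scope.

(** * Arrays, differential and cup product with natural-number indices *)

Section NatIndexedArrays.
Variables (k : fieldType) (A : algType k) (B : comAlgType k).
Implicit Types (a : nat -> A) (b : nat -> nat -> B).

(* With entries indexed by natural numbers, an array of size m + n.+1 and one of
   size (m + n).+1 can be compared without transporting along addnS. *)
Definition arr n a b : tri A B n := of_entries (fun i => a i) (fun i j => b i j).

Lemma arr_surj n (T : tri A B n) : exists a b, T = arr n a b.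
Proof.
(* The defaults 0 and 1 are taken at indices out of range, which [arr n] never reads. *)
exists (fun i => if insub i is Some j then diag T j else 0).
exists (fun i j => if (insub i, insub j) is (Some r, Some s) then entry T r s else 1).
apply: triP => [i|[[r s] rs]] /=; first by rewrite valK.
rewrite !valK /entry /=.
by rewrite insubT /=; congr (offd T _); apply: val_inj.
Qed.

Lemma eq_arr n a a' b b' :
  (forall i, (i < n)%N -> a i = a' i) ->
  (forall i j, (i < j < n)%N -> b i j = b' i j) -> arr n a b = arr n a' b'.
Proof.
move=> ea eb; apply: triP => [i|[[r s] rs]] /=; first exact: ea.
by apply: eb; rewrite rs /=.
Qed.

Lemma entry_arr n a b (i j : 'I_n) : (i < j)%N -> entry (arr n a b) i j = b i j.
Proof. by move=> ij; rewrite /entry insubT. Qed.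

Lemma subarray_arr m n (h : 'I_m -> 'I_n) (v : nat -> nat) a b :
  (forall i, val (h i) = v i) -> {homo v : i j / (i < j)%N} ->
  subarray h (arr n a b) = arr m (a \o v) (fun i j => b (v i) (v j)).
Proof.
move=> hv vlt; apply: triP => [i|[[r s] rs]] /=; first by rewrite -hv.
by rewrite entry_arr !hv ?vlt.
Qed.

Lemma cochain_arrP n (f g : cochain A B n) :
  (forall a b, f (arr n a b) = g (arr n a b)) -> f = g.
Proof. by move=> fg; apply: cochainP => T; have [a [b ->]] := arr_surj T. Qed.

Variable eps : {lrmorphism B -> A}.

(** The size does not occur, and [bump i.+1] skips the index [i.+1]: one formula thus describes
    merges in an array and in its blocks. *)
Definition merge_diag i a b r : A :=
  if r == i then eps (b i i.+1) * a i * a i.+1 else a (bump i.+1 r).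

Definition merge_offd i b r s : B :=
  if s == i then b (bump i.+1 r) i * b (bump i.+1 r) i.+1
  else if r == i then b i (bump i.+1 s) * b i.+1 (bump i.+1 s)
  else b (bump i.+1 r) (bump i.+1 s).

Lemma merge_arr n (i : 'I_n) a b :
  Defs.merge eps i (arr n.+1 a b) = arr n (merge_diag i a b) (merge_offd i b).
Proof.
apply: triP => [r|[[r s] rs]] /=; rewrite /merge_diag /merge_offd -!val_eqE /=.
  by rewrite entry_arr //= /bump.
move: rs => /= rs.
case: eqP => si.
  by rewrite !entry_arr //= /bump /=; lia.
by case: eqP => ri; rewrite !entry_arr //= /bump /=; lia.
Qed.

Lemma delta_arr n (f : tri A B n -> A) a b :
  delta_fun eps f (arr n.+1 a b) =
  a 0 * eps (\prod_(j < n) b 0 j.+1) * f (arr n (a \o S) (fun i j => b i.+1 j.+1))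
  + \sum_(i < n) (-1) ^+ i.+1 * f (arr n (merge_diag i a b) (merge_offd i b))
  + (-1) ^+ n.+1 * f (arr n a b) * a n * eps (\prod_(i < n) b i n).
Proof.
rewrite /delta_fun (@subarray_arr _ _ _ S) // (@subarray_arr _ _ _ id) //=.
congr (_ * eps _ * _ + _ + _ * _ * _ * eps _).
- by apply: eq_bigr => j _; rewrite entry_arr.
- by apply: eq_bigr => i _; rewrite merge_arr.
- by apply: eq_bigr => i _; rewrite entry_arr /=.
Qed.

Lemma cup_arr m n (f : tri A B m -> A) (g : tri A B n -> A) a b :
  cup_fun eps f g (arr (m + n) a b) =
  f (arr m a b) * g (arr n (a \o addn m) (fun i j => b (m + i)%N (m + j)%N))
  * eps (\prod_(i < m) \prod_(j < n) b i (m + j)%N).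
Proof.
rewrite /cup_fun (@subarray_arr _ _ _ id) // (@subarray_arr _ _ _ (addn m)) //=; last first.
  by move=> i j ij; rewrite ltn_add2l.
congr (_ * _); rewrite rmorph_prod; apply: eq_bigr => i _.
rewrite rmorph_prod; apply: eq_bigr => j _.
by rewrite entry_arr //= ltn_addr.
Qed.

(** [bump i.+1] enumerates all indices except [i.+1], whose factor is restored at [i]. Applied to
    rows or to columns, this makes the products over pairs invariant under merging. *)
Lemma prod_merge n i (F : nat -> B) : (i < n)%N ->
  \prod_(r < n) (if val r == i then F i * F i.+1 else F (bump i.+1 r)) =
  \prod_(r < n.+1) F r.
Proof.
move=> lin; pose j := Ordinal lin.
rewrite [RHS](bigD1_ord (lift ord0 j)) //= (bigD1 j) //= eqxx.
have bi : bump i.+1 i = i by rewrite /bump ltnn.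
rewrite [in RHS](bigD1 j) //= bi mulrCA mulrA.
by congr (_ * _); apply: eq_bigr => r /negPf; rewrite -val_eqE => ->.
Qed.

(** * The Leibniz rule *)

Variable eps_central : forall (b : B) (a : A), eps b * a = a * eps b.

Section Leibniz.
Variables (m n : nat) (f : tri A B m -> A) (g : tri A B n -> A).
Variables (a : nat -> A) (b : nat -> nat -> B).

(** A merge in the first block shifts the second block by one and multiplies two rows of the pair
    product. *)
Lemma cup_merge_lshift i : (i < m)%N ->
  cup_fun eps f g (arr (m + n) (merge_diag i a b) (merge_offd i b)) =
  f (arr m (merge_diag i a b) (merge_offd i b))
  * g (arr n (a \o addn m.+1) (fun r s => b (m.+1 + r)%N (m.+1 + s)%N))
  * eps (\prod_(r < m.+1) \prod_(s < n) b r (m.+1 + s)%N).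
Proof.
move=> im; rewrite cup_arr; congr (_ * g _ * eps _).
  apply: eq_arr => [r _|r s rs] /=; rewrite /merge_diag /merge_offd /bump.
    by rewrite gtn_eqF ?ltn_addr // addSn.
  by rewrite !gtn_eqF ?ltn_addr // !addSn.
rewrite -(@prod_merge m i (fun r => \prod_(s < n) b r (m.+1 + s)%N)) //.
apply: eq_bigr => r _; case: ifP => ri; last first.
  by apply: eq_bigr => s _; rewrite /merge_offd ri gtn_eqF ?ltn_addr // {2}/bump ltn_addr.
rewrite -big_split; apply: eq_bigr => s _ /=.
by rewrite /merge_offd ri gtn_eqF ?ltn_addr // /bump ltn_addr.
Qed.

(** A merge in the second block fixes the first block and multiplies two columns of the pair
    product. *)
Lemma cup_merge_rshift i : (i < n)%N ->
  cup_fun eps f g (arr (m + n) (merge_diag (m + i) a b) (merge_offd (m + i) b)) =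
  f (arr m a b)
  * g (arr n (merge_diag i (a \o addn m) (fun r s => b (m + r)%N (m + s)%N))
         (merge_offd i (fun r s => b (m + r)%N (m + s)%N)))
  * eps (\prod_(r < m) \prod_(s < n.+1) b r (m + s)%N).
Proof.
move=> lin; rewrite cup_arr.
have bm r : bump (m + i).+1 (m + r) = (m + bump i.+1 r)%N.
  by rewrite /bump -addnS leq_add2l addnCA.
have lt r : (r < m)%N -> (r == m + i)%N = false /\ bump (m + i).+1 r = r.
  by rewrite /bump; split; lia.
congr (f _ * g _ * eps _).
- apply: eq_arr => [r rm|r s /andP[rs sm]]; rewrite /merge_diag /merge_offd.
    by have [-> ->] := lt r rm.
  by have [-> ->] := lt s sm; have [-> ->] := lt r (ltn_trans rs sm).
- apply: eq_arr => [r _|r s _] /=; rewrite /merge_diag /merge_offd /=.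
    by rewrite eqn_add2l bm addnS.
  by rewrite !eqn_add2l !bm !addnS.
- apply: eq_bigr => r _; rewrite -(@prod_merge n i (fun s => b r (m + s)%N)) //.
  have [ri br] := lt r (ltn_ord r).
  apply: eq_bigr => s _; rewrite /merge_offd eqn_add2l ri bm br.
  by rewrite addnS.
Qed.

(* The last term of [delta f] in the first product cancels the first term of
   [delta g] in the second. *)
Lemma cup_leibniz_arr :
  delta_fun eps (cup_fun eps f g) (arr (m + n).+1 a b) =
  cup_fun eps (delta_fun eps f) g (arr (m.+1 + n) a b)
  + (-1) ^+ m * cup_fun eps f (delta_fun eps g) (arr (m + n.+1) a b).
Proof.
have epsl (x : A) y z : x * (eps y * z) = eps y * (x * z).
  by rewrite !mulrA eps_central.
have signl p (x z : A) : x * ((-1) ^+ p * z) = (-1) ^+ p * (x * z).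
  by rewrite !mulrA commr_sign.
rewrite [in LHS]delta_arr [cup_fun _ f _ _ in RHS]cup_arr.
rewrite [cup_fun _ (delta_fun _ _) _ _ in RHS]cup_arr !delta_arr.
rewrite (@big_split_ord _ _ +%R) /=.
under [X in _ + (X + _) + _]eq_bigr => i _ do rewrite cup_merge_lshift //.
under [X in _ + (_ + X) + _]eq_bigr => i _ do rewrite cup_merge_rshift //.
rewrite !cup_arr.
rewrite !mulrDl !mulrDr !mulrDl !mulrDr.
(* The equation reads [x0 + (xl + xr) + x1 = y0 + yl + z + (z' + yr + y1)]. Terms with the same
   suffix agree, and [z'] cancels [z]. *)
set x0 := (X in X + _ + _ = _); set xl := (X in _ + (X + _) + _ = _).
set xr := (X in _ + (_ + X) + _ = _); set x1 := (X in _ + (_ + _) + X = _).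
set y0 := (X in _ = X + _ + _ + _); set yl := (X in _ = _ + X + _ + _).
set z := (X in _ = _ + X + _); set z' := (X in _ = _ + (X + _ + _)).
set yr := (X in _ = _ + (_ + X + _)); set y1 := (X in _ = _ + (_ + X)).
have <- : x0 = y0.
  (* Gathering the central factors reduces the comparison to an identity in the commutative algebra
     [B]; the same device serves for [x1] and [z']. *)
  have E u p x y q r s : p * q = r * s ->
      u * eps p * (x * y * eps q) = u * eps r * x * y * eps s.
    move=> pq; rewrite -!mulrA -(eps_central q) -(eps_central s).
    by rewrite !(epsl _ q) !(epsl _ s) !(epsl u) !mulrA -!rmorphM mulrC pq mulrC.
  rewrite /y0 -[g _]/(g (arr n ((a \o succn) \o addn m) (fun i j => b (m + i).+1 (m + j).+1))).
  apply: E; rewrite (@big_split_ord _ _ *%R) /= big_ord_recl -mulrA; congr (_ * _).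
have <- : xl = yl.
  by rewrite /xl /yl !mulr_suml; apply: eq_bigr => i _; rewrite !mulrA.
have <- : xr = yr.
  rewrite /xr /yr !(mulr_sumr, mulr_suml); apply: eq_bigr => i _.
  by rewrite -addnS exprD -!mulrA (signl _ (f _)).
have <- : x1 = y1.
  have E p x y u r s t : p * r = s * t ->
      (-1) ^+ (m + n).+1 * (x * y * eps p) * u * eps r =
      (-1) ^+ m * (x * ((-1) ^+ n.+1 * y * u * eps s) * eps t).
    move=> pr; rewrite -addnS exprD -!mulrA (signl _ x); do 4 congr (_ * _).
    by rewrite (eps_central p) -mulrA -!rmorphM (mulrC r) pr.
  apply: E; rewrite (@big_split_ord _ _ *%R) /= mulrA [RHS]mulrC; congr (_ * _).
  by rewrite -big_split; apply: eq_bigr => i _; rewrite big_ord_recr.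
(* In both terms [a m] stands between [f] and [g]. Row [m] belongs to the pair product in [z] and to
   the differential in [z']; for column [m] it is the reverse. *)
have -> : z' = - z.
  have E x u p y q r s : p * q = r * s ->
      (-1) ^+ m * (x * (u * eps r * y) * eps s) =
      - ((-1) ^+ m.+1 * x * u * eps p * y * eps q).
    move=> pq; rewrite exprS mulN1r !mulNr opprK -!mulrA; do 3 congr (_ * _).
    by rewrite -!eps_central !mulrA -!rmorphM pq.
  rewrite /z' /z addn0.
  have -> : arr n ((a \o addn m) \o S) (fun i j => b (m + i.+1)%N (m + j.+1)%N) =
      arr n (a \o addn m.+1) (fun i j => b (m.+1 + i)%N (m.+1 + j)%N).
    by apply: eq_arr => [i _|i j _] /=; rewrite !addnS.
  apply: E; rewrite big_ord_recr /= mulrA mulrC; congr (_ * _).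
    by apply: eq_bigr => i _; rewrite addnS.
  rewrite -big_split; apply: eq_bigr => i _ /=.
  by rewrite big_ord_recl addn0; under [in RHS]eq_bigr do rewrite lift0 addnS.
by rewrite -!addrA addNKr.
Qed.

End Leibniz.

(** Since [f] is arbitrary, this serves both for products of cocycles and, with [f] a primitive, for
    products with coboundaries. *)
Lemma cup_leibniz_cocycle_l m n (f : cochain A B m) (g : cochain A B n) a b :
  delta eps g = 0 ->
  delta eps (cup eps f g) (arr (m + n).+1 a b) =
  cup eps (delta eps f) g (arr (m.+1 + n) a b).
Proof.
move=> dg; rewrite /= cup_leibniz_arr // [X in _ + _ * X]cup_arr.
rewrite -[delta_fun eps g _]/(delta eps g _) dg /=.
by rewrite mulr0 mul0r mulr0 addr0.
Qed.

Lemma cup_leibniz_cocycle_r m n (f : cochain A B m) (g : cochain A B n) a b :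
  delta eps f = 0 ->
  delta eps (cup eps f g) (arr (m + n).+1 a b) =
  (-1) ^+ m * cup eps f (delta eps g) (arr (m + n.+1) a b).
Proof.
move=> df; rewrite /= cup_leibniz_arr // [X in X + _]cup_arr.
rewrite -[delta_fun eps f _]/(delta eps f _) df /=.
by rewrite !mul0r add0r.
Qed.

(** * Products of cocycles and coboundaries *)

Lemma cup_cocycle m n (f : cocycle eps m) (g : cocycle eps n) :
  cup eps f g \in @is_cocycle _ _ _ eps (m + n)%N.
Proof.
have /eqP df := cocycle_valP f; have /eqP dg := cocycle_valP g.
rewrite inE; apply/eqP/cochain_arrP => a b.
by rewrite cup_leibniz_cocycle_l // df /= cup_arr !mul0r.
Qed.

Definition cocycle_cup m n (f : cocycle eps m) (g : cocycle eps n) :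
  cocycle eps (m + n)%N := Cocycle (cup_cocycle f g).

Lemma cocycle_arrP n (f g : cocycle eps n) :
  (forall a b, f (arr n a b) = g (arr n a b)) -> f = g.
Proof. by move=> fg; apply: val_inj; apply: cochain_arrP. Qed.

Lemma cocycle_cup_linear_l m n (g : cocycle eps n) :
  linear (fun f : cocycle eps m => cocycle_cup f g).
Proof.
move=> c f f'; apply: cocycle_arrP => a b.
transitivity (c *: cup eps f g (arr (m + n) a b) + cup eps f' g (arr (m + n) a b)) => //=.
by rewrite !cup_arr /= !mulrDl -!scalerAl.
Qed.

Lemma cocycle_cup_linear_r m n (f : cocycle eps m) :
  linear (fun g : cocycle eps n => cocycle_cup f g).
Proof.
move=> c g g'; apply: cocycle_arrP => a b.
transitivity (c *: cup eps f g (arr (m + n) a b) + cup eps f g' (arr (m + n) a b)) => //=.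
by rewrite !cup_arr /= mulrDr !mulrDl -!scalerAr -!scalerAl.
Qed.

(** Exchanging the arguments allows linearity in the first factor to be declared as an instance. *)
Definition cocycle_cupr m n (g : cocycle eps n) (f : cocycle eps m) := cocycle_cup f g.

HB.instance Definition _ m n g := GRing.isLinear.Build k (cocycle eps m)
  (cocycle eps (m + n)%N) *:%R (@cocycle_cupr m n g) (@cocycle_cup_linear_l m n g).

HB.instance Definition _ m n f := GRing.isLinear.Build k (cocycle eps n)
  (cocycle eps (m + n)%N) *:%R (@cocycle_cup m n f) (@cocycle_cup_linear_r m n f).

(** The degree equation [e] covers [m + n.+1], which is not convertible to [(m + n).+1]; comparing
    values on [arr] avoids a cast. *)
Lemma coboundary_arr n m (e : n = m.+1) (f : cocycle eps n) (h : cochain A B m) :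
  (forall a b, f (arr n a b) = delta eps h (arr m.+1 a b)) -> f \in @coboundary _ _ _ eps n.
Proof.
subst n => fh; rewrite inE; apply/asboolP; exists h.
exact: cochain_arrP.
Qed.

Lemma cocycle_cup_coboundary_l m n (f : cocycle eps m) (g : cocycle eps n) :
  f \in @coboundary _ _ _ eps m -> cocycle_cup f g \in @coboundary _ _ _ eps (m + n)%N.
Proof.
have /eqP dg := cocycle_valP g.
case: m f => [|m] f; rewrite inE.
  by move=> /eqP->; rewrite -[cocycle_cup _ _]/(cocycle_cupr g 0) linear0 rpred0.
move=> /asboolP[h fh]; apply: (@coboundary_arr _ (m + n)%N _ _ (cup eps h g)) => // a b.
by rewrite cup_leibniz_cocycle_l //= fh.
Qed.

Lemma cocycle_cup_coboundary_r m n (f : cocycle eps m) (g : cocycle eps n) :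
  g \in @coboundary _ _ _ eps n -> cocycle_cup f g \in @coboundary _ _ _ eps (m + n)%N.
Proof.
have /eqP df := cocycle_valP f.
case: n g => [|n] g; rewrite inE.
  by move=> /eqP->; rewrite linear0 rpred0.
move=> /asboolP[h gh].
(* As [f] is a cocycle, d(f h) = (-1)^m f (dh); the sign in the witness cancels this one. *)
apply: (@coboundary_arr _ (m + n)%N (addnS m n) _ ((-1) ^+ m *: cup eps f h)) => a b.
rewrite linearZ /=.
transitivity ((-1) ^+ m *: delta eps (cup eps f h) (arr (m + n).+1 a b)) => //.
(* One sign is a scalar in [k], the other an element of [A]; both are reduced to the parity of
   [m]. *)
rewrite cup_leibniz_cocycle_r // -gh -signr_odd -[in X in _ *: X]signr_odd.
by rewrite mulr_sign scaler_sign; case: odd; rewrite ?opprK.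
Qed.

(** * The cup product on cohomology classes *)

Definition cohomology_cup m n (x : cohomology eps m) (y : cohomology eps n) :
  cohomology eps (m + n)%N := cohomology_class (cocycle_cup (repr x) (repr y)).

(** Independence of representatives: f' g' - f g = f' (g' - g) + (f' - f) g is a sum of two
    coboundaries. *)
Lemma cohomology_cup_class m n (f : cocycle eps m) (g : cocycle eps n) :
  cohomology_cup (cohomology_class f) (cohomology_class g) =
  cohomology_class (cocycle_cup f g).
Proof.
apply/quotmod_piE; set f' : cocycle eps m := repr _; set g' : cocycle eps n := repr _.
have ff' : f' - f \in @coboundary _ _ _ eps m.
  by apply/quotmod_piE; rewrite /quotmod_pi reprK.
have gg' : g' - g \in @coboundary _ _ _ eps n.
  by apply/quotmod_piE; rewrite /quotmod_pi reprK.
rewrite (_ : _ - _ = cocycle_cup f' (g' - g) + cocycle_cup (f' - f) g).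
  apply: rpredD.
    exact: cocycle_cup_coboundary_r.
  exact: cocycle_cup_coboundary_l.
rewrite -[cocycle_cup (f' - f) g]/(cocycle_cupr g (f' - f)) !linearB /=.
by rewrite addrA subrK.
Qed.

Lemma cohomology_class_surj n (x : cohomology eps n) : exists f, x = cohomology_class f.
Proof. exact: quotmod_pi_surj. Qed.

Lemma cohomology_class_linear n : linear (@cohomology_class _ _ _ eps n).
Proof. exact: linearP. Qed.

Lemma cohomology_cup_linear_l m n (y : cohomology eps n) :
  linear (fun x : cohomology eps m => cohomology_cup x y).
Proof.
move=> c x x'; have [g ->] := cohomology_class_surj y.
have [f ->] := cohomology_class_surj x; have [f' ->] := cohomology_class_surj x'.
rewrite -cohomology_class_linear !cohomology_cup_class -cohomology_class_linear.
by rewrite cocycle_cup_linear_l.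
Qed.

Lemma cohomology_cup_linear_r m n (x : cohomology eps m) :
  linear (fun y : cohomology eps n => cohomology_cup x y).
Proof.
move=> c y y'; have [f ->] := cohomology_class_surj x.
have [g ->] := cohomology_class_surj y; have [g' ->] := cohomology_class_surj y'.
rewrite -cohomology_class_linear !cohomology_cup_class -cohomology_class_linear.
by rewrite cocycle_cup_linear_r.
Qed.

(** Classes whose degrees are only provably equal are compared inside the direct sum, without a
    cast. *)
Lemma dsum_in_class_arr m n (e : m = n) (f : cocycle eps m) (g : cocycle eps n) :
  (forall a b, f (arr m a b) = g (arr n a b)) ->
  dsum_in (cohomology_class f) = dsum_in (cohomology_class g).
Proof. by case: n / e g => g fg; congr (dsum_in (cohomology_class _)); exact: cocycle_arrP. Qed.

Lemma cohomology_cupA l m n (x : cohomology eps l) (y : cohomology eps m)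
    (z : cohomology eps n) :
  dsum_in (cohomology_cup x (cohomology_cup y z)) =
  dsum_in (cohomology_cup (cohomology_cup x y) z).
Proof.
have [f ->] := cohomology_class_surj x; have [g ->] := cohomology_class_surj y.
have [h ->] := cohomology_class_surj z; rewrite !cohomology_cup_class.
apply: (dsum_in_class_arr (addnA l m n)) => a b; rewrite /= !cup_arr /=.
have -> : arr n (a \o addn (l + m)) (fun i j => b (l + m + i)%N (l + m + j)%N) =
    arr n ((a \o addn l) \o addn m) (fun i j => b (l + (m + i))%N (l + (m + j))%N).
  by apply: eq_arr => [i _|i j _] /=; rewrite -!addnA.
have E (u v w : A) p q r s : p * q = r * s ->
    u * (v * w * eps p) * eps q = u * v * eps r * w * eps s.
  move=> pq; rewrite -!mulrA; do 2 congr (_ * _).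
  by rewrite -rmorphM pq -(eps_central s) [RHS]mulrA -rmorphM eps_central.
(* Both sides multiply the entries joining different blocks among the three of sizes [l], [m],
   [n]. *)
apply: E; rewrite [X in _ = _ * X](@big_split_ord _ _ *%R) /= mulrA [RHS]mulrC.
congr (_ * _).
  by apply: eq_bigr => i _; apply: eq_bigr => j _; rewrite addnA.
rewrite -big_split; apply: eq_bigr => i _; rewrite (@big_split_ord _ _ *%R) /=.
by congr (_ * _); apply: eq_bigr => j _; rewrite addnA.
Qed.

(** Multilinearity is vacuous in size 0, and the differential of the constant 1 is [a 0 - a 0]. *)
Lemma one_cocycle_exists : exists u : cocycle eps 0, forall T, u T = 1.
Proof.
have c1 : (fun _ : tri A B 0 => 1 : A) \in @is_cochain _ _ _ 0.
  by apply/asboolP; split=> T [] // [[]].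
have d1 : Cochain c1 \in @is_cocycle _ _ _ eps 0.
  rewrite inE; apply/eqP/cochain_arrP => a b.
  by rewrite /= delta_arr !big_ord0 rmorph1 !mulr1 addr0 expr1 mulN1r subrr.
by exists (Cocycle d1).
Qed.

End NatIndexedArrays.

(** * Extending a bilinear graded product to the direct sum *)

Section GradedProduct.
Variables (k : pzRingType) (V : nat -> lmodType k).
Variable p : forall m n, V m -> V n -> V (m + n)%N.
Hypothesis p_linear_l : forall m n (y : V n), linear (fun x : V m => p x y).
Hypothesis p_linear_r : forall m n (x : V m), linear (@p m n x).

Local Notation D := (dsum V).

Lemma dsum_in_out n (x : V n) m : m <> n -> dsum_in x m = 0.
Proof. by move=> mn; rewrite /= dfwith_out //; apply/eqP => /esym. Qed.

Lemma dsum_in0 m n : dfwith (fun n => 0 : V n) (0 : V m) n = 0.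
Proof. by rewrite -[LHS]/(dsum_in 0 n) linear0. Qed.

Lemma p0l m n (y : V n) : p (0 : V m) y = 0.
Proof. by rewrite -[0 in LHS](addNr 0) -scaleN1r p_linear_l scaleN1r addNr. Qed.

Lemma p0r m n (x : V m) : p x (0 : V n) = 0.
Proof. by rewrite -[0 in LHS](addNr 0) -scaleN1r p_linear_r scaleN1r addNr. Qed.

(* [dsum_in _ n] discards the summands with i + j != n, which avoids casting
   from degree i + (n - i) to degree n. *)
Definition dsum_mul_val (x y : D) n : V n :=
  \sum_(i < n.+1) \sum_(j < n.+1) dsum_in (p (x i) (y j)) n.

Lemma dsum_mul_subproof (x y : D) :
  exists N, forall n, (N <= n)%N -> dsum_mul_val x y n = 0.
Proof.
have [N xN] := dsum_finite x; have [M yM] := dsum_finite y.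
exists (N + M)%N => n NMn; apply: big1 => i _; apply: big1 => j _.
have [Ni|iN] := leqP N i; first by rewrite xN // p0l linear0.
have [Mj|jM] := leqP M j; first by rewrite yM // p0r linear0.
(* Here [i < N] and [j < M], so [i + j] cannot be [n]. *)
by apply: dsum_in_out; lia.
Qed.

Definition dsum_mul (x y : D) : D := DSum (dsum_mul_subproof x y).

Lemma dsum_mul_in m n (x : V m) (y : V n) :
  dsum_mul (dsum_in x) (dsum_in y) = dsum_in (p x y).
Proof.
apply: dsumP => l; rewrite [LHS]/(dsum_mul_val _ _ l) /dsum_mul_val.
(* If [l < m + n], the pair [(m, n)] may lie outside the summation range; if it lies inside, its
   term has the wrong degree. *)
have [lmn|] := ltnP l (m + n).
  rewrite dsum_in_out ?big1 // => [i _|]; last by lia.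
  apply: big1 => j _; have [/eqP im|/eqP im] := boolP (i == m :> nat); last first.
    by rewrite [dsum_in x i]dsum_in_out // p0l linear0.
  have [/eqP jn|/eqP jn] := boolP (j == n :> nat); last first.
    by rewrite [dsum_in y j]dsum_in_out // p0r linear0.
  by rewrite dsum_in_out //; lia.
move=> mnl.
have ml : (m < l.+1)%N by lia.
have nl : (n < l.+1)%N by lia.
have xout (i : 'I_l.+1) : i != Ordinal ml -> dsum_in x i = 0.
  by move=> im; apply: dsum_in_out; apply/eqP.
have yout (j : 'I_l.+1) : j != Ordinal nl -> dsum_in y j = 0.
  by move=> jn; apply: dsum_in_out; apply/eqP.
rewrite (bigD1 (Ordinal ml)) //= [X in _ + X]big1 => [|i /xout /= xi]; last first.
  by apply: big1 => j _; rewrite xi p0l dsum_in0.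
rewrite (bigD1 (Ordinal nl)) //= [X in _ + X + _]big1 => [|j /yout /= yj]; last first.
  by rewrite yj p0r dsum_in0.
by rewrite !addr0 !dfwith_in.
Qed.

Lemma dsum_mul_linear_l y : linear (dsum_mul^~ y).
Proof.
move=> c x x'; apply: dsumP => n.
transitivity (c *: dsum_mul_val x y n + dsum_mul_val x' y n) => //=.
rewrite /dsum_mul_val scaler_sumr -big_split; apply: eq_bigr => i _ /=.
rewrite scaler_sumr -big_split; apply: eq_bigr => j _ /=.
by rewrite p_linear_l -![dfwith _ _ n]/(dsum_in _ n) linearP.
Qed.

Lemma dsum_mul_linear_r x : linear (dsum_mul x).
Proof.
move=> c y y'; apply: dsumP => n.
transitivity (c *: dsum_mul_val x y n + dsum_mul_val x y' n) => //=.
rewrite /dsum_mul_val scaler_sumr -big_split; apply: eq_bigr => i _ /=.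
rewrite scaler_sumr -big_split; apply: eq_bigr => j _ /=.
by rewrite p_linear_r -![dfwith _ _ n]/(dsum_in _ n) linearP.
Qed.

Lemma dsum_sum_val (I : Type) (s : seq I) (F : I -> D) n :
  (\sum_(i <- s) F i) n = \sum_(i <- s) F i n.
Proof. by elim/big_rec2: _ => [|i u v _ <-]. Qed.

Lemma dsum_decomp (x : D) : exists N, x = \sum_(i < N) dsum_in (x i).
Proof.
have [N xN] := dsum_finite x; exists N; apply: dsumP => n.
rewrite dsum_sum_val; have [Nn|nN] := leqP N n.
  by rewrite xN // big1 // => i _; apply: dsum_in_out; have := ltn_ord i; lia.
rewrite (bigD1 (Ordinal nN)) //= dfwith_in big1 ?addr0 // => i iN.
by rewrite dfwith_out.
Qed.

Lemma dsum_linear_ext (F G : D -> D) : linear F -> linear G ->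
  (forall n (x : V n), F (dsum_in x) = G (dsum_in x)) -> F =1 G.
Proof.
move=> lF lG FG x; have [N ->] := dsum_decomp x.
(* The maps are bundled so that [linear_sum] applies to the homogeneous decomposition. *)
pose LF := GRing.isLinear.Build k D D *:%R F lF.
pose LG := GRing.isLinear.Build k D D *:%R G lG.
pose F' : {linear D -> D} := HB.pack F LF.
pose G' : {linear D -> D} := HB.pack G LG.
rewrite -[F _]/(F' _) -[G _]/(G' _) !linear_sum; apply: eq_bigr => i _; exact: FG.
Qed.

(** * Associativity and unit on the direct sum *)

Hypothesis pA : forall l m n (x : V l) (y : V m) (z : V n),
  dsum_in (p x (p y z)) = dsum_in (p (p x y) z).

Lemma dsum_mulA : associative dsum_mul.
Proof.
move=> x y z; move: x; apply: dsum_linear_ext => [||l x].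
- exact: dsum_mul_linear_l.
- by move=> c x x'; rewrite !dsum_mul_linear_l.
move: y; apply: dsum_linear_ext => [||m y].
- by move=> c y y'; rewrite dsum_mul_linear_l dsum_mul_linear_r.
- by move=> c y y'; rewrite dsum_mul_linear_r dsum_mul_linear_l.
move: z; apply: dsum_linear_ext => [||n z].
- by move=> c z z'; rewrite !dsum_mul_linear_r.
- exact: dsum_mul_linear_r.
by rewrite !dsum_mul_in pA.
Qed.

Variable u : V 0%N.
Hypothesis pul : forall n (x : V n), dsum_in (p u x) = dsum_in x.
Hypothesis pur : forall n (x : V n), dsum_in (p x u) = dsum_in x.

Lemma dsum_graded_algebra : graded_algebra dsum_mul.
Proof.
split; first by split; [exact: dsum_mul_linear_r|exact: dsum_mul_linear_l].
- exact: dsum_mulA.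
- exists u; split; apply: dsum_linear_ext => // [|n x].
  + exact: dsum_mul_linear_r.
  + by rewrite dsum_mul_in.
  + exact: dsum_mul_linear_l.
  + by rewrite dsum_mul_in.
- by move=> m n x y; exists (p x y); exact: dsum_mul_in.
Qed.

End GradedProduct.

Theorem proposition2p1 (k : fieldType) (A : algType k) (B : comAlgType k)
    (eps : {lrmorphism B -> A})
    (eps_central : forall (b : B) (a : A), eps b * a = a * eps b) :
  exists2 mul : total_cohomology eps -> total_cohomology eps -> total_cohomology eps,
    graded_algebra mul &
    forall (m n : nat) (f : cocycle eps m) (g : cocycle eps n),
      exists2 h : cocycle eps (m + n),
        cocycle_val h = cup eps f g &
        mul (dsum_in (cohomology_class f)) (dsum_in (cohomology_class g))
        = dsum_in (cohomology_class h).
Proof.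
have [u u1] := one_cocycle_exists eps.
pose p m n := @cohomology_cup k A B eps eps_central m n.
have pl m n y : linear (fun x => p m n x y) by exact: cohomology_cup_linear_l.
have pr m n x : linear (p m n x) by exact: cohomology_cup_linear_r.
exists (dsum_mul pl pr).
  apply: (@dsum_graded_algebra _ _ _ _ _ _ (cohomology_class u)).
  - exact: cohomology_cupA.
  - move=> n x; have [f ->] := cohomology_class_surj x.
    rewrite /p cohomology_cup_class; apply: dsum_in_class_arr => // a b.
    by rewrite /= cup_arr u1 big_ord0 rmorph1 mulr1 mul1r.
  - move=> n x; have [f ->] := cohomology_class_surj x.
    (* Unlike [0 + n], the degree [n + 0] is not convertible to [n]. The pair product has no
       columns, so it is 1. *)
    rewrite /p cohomology_cup_class; apply: dsum_in_class_arr => [|a b]; first exact: addn0.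
    rewrite /= cup_arr u1 big1 ?rmorph1 ?mulr1 // => i _.
    by rewrite big_ord0.
move=> m n f g; exists (cocycle_cup eps_central f g) => //.
by rewrite dsum_mul_in /p cohomology_cup_class.
Qed.
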